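(* Let $k = k(p)$ satisfy $k \to \infty$ and $k = o(p)$ as $p \to \infty$, and suppose that the number of tests satisfies $n = \Omega\big(k \log \frac{p}{k}\big)$, with any (arbitrarily small) positive implied constant. Then there exists a (sequence, indexed by $p$, of) non-adaptive test design with $n$ tests and decoder that outputs an estimate $\hat S$ of the defective set $S$ of cardinality $k$ satisfying $|\hat S \cap S| = \Omega(k)$ with probability approaching one as $p \to \infty$. (That is: for every constant $c_0>0$ there is a constant $\delta>0$ such that, whenever $n \ge c_0 k\log\frac{p}{k}$ for all sufficiently large $p$, there are designs and decoders with $\mathbb{P}[\,|\hat S|=k,\ |\hat S \cap S| \ge \delta k\,] \to 1$.)
   Context: Probabilistic (noiseless) group testing: there are $p$ items $\{1,\dots,p\}$, and the defective set $S$ is uniformly distributed over the $\binom{p}{k}$ subsets of $\{1,\dots,p\}$ of cardinality $k$. A non-adaptive test design with $n$ tests is a (possibly random) matrix $\mathbf{X} \in \{0,1\}^{n\times p}$, independent of $S$, whose entry $X^{(i)}_j$ equals $1$ iff item $j$ is included in test $i$. The outcomes are $\mathbf{Y} \in \{0,1\}^n$ with $Y^{(i)} = \bigvee_{j \in S} X^{(i)}_j$. A decoder outputs an estimate $\hat S \subseteq \{1,\dots,p\}$ based on $(\mathbf{X},\mathbf{Y})$ (and knowledge of $p,k$), possibly with randomization. Probabilities are over $S$, $\mathbf{X}$ and any randomness of the decoder. *)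

(* Defs.v *)
From HB Require Import structures.
From mathcomp Require Import all_boot all_order all_algebra.
From mathcomp Require Import all_classical all_reals all_analysis.
Set Implicit Arguments.
Unset Strict Implicit.
Unset Printing Implicit Defensive.
Import Order.TTheory GRing.Theory Num.Theory.
Import numFieldNormedType.Exports.
Local Open Scope ring_scope.

Record fdist (R : realType) (T : finType) := FDist {
  mass :> T -> R;
  mass_ge0 : forall t, 0 <= mass t;
  mass_sum1 : \sum_t mass t = 1 }.

(* Items are 'I_p, tests are 'I_n; [X i j] says that item j is in test i. *)
Definition outcome (n p : nat) (X : 'M[bool]_(n, p)) (S : {set 'I_p}) :
  {ffun 'I_n -> bool} := [ffun i => [exists j in S, X i j]].

Definition design (R : realType) (n p : nat) := fdist R 'M[bool]_(n, p).

(* A randomized decoder is a Markov kernel: given (X, Y), it returns the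
   conditional law of the estimate, which sees S only through (X, Y). *)
Definition decoder (R : realType) (n p : nat) :=
  'M[bool]_(n, p) -> {ffun 'I_n -> bool} -> fdist R {set 'I_p}.

(* Uniform on the k-subsets; a probability mass function only if k <= p, and
   identically 0 otherwise (see [defective_mass_sum1]). *)
Definition defective_mass (R : realType) (p k : nat) (S : {set 'I_p}) : R :=
  if #|S| == k then ('C(p, k)%:R)^-1 else 0.

(* Probability of an event on (defective set, estimate), under the joint law of
   (S, X, estimate) in which X is independent of S. *)
Definition Pr (R : realType) (n p k : nat) (Q : design R n p)
    (D : decoder R n p) (E : {set 'I_p} -> {set 'I_p} -> bool) : R :=
  \sum_(S : {set 'I_p}) \sum_(X : 'M[bool]_(n, p))
    \sum_(T : {set 'I_p} | E S T)
      defective_mass R k S * Q X * D X (outcome X S) T.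

Lemma defective_mass_sum1 (R : realType) (p k : nat) : (k <= p)%N ->
  \sum_(S : {set 'I_p}) defective_mass R k S = 1.
Proof.
move=> kp; rewrite -big_mkcond /= sumr_const.
have -> : #|[pred S : {set 'I_p} | #|S| == k]| = 'C(p, k).
  by rewrite -[in RHS](card_ord p) -card_draws cardsE.
by rewrite -[LHS]mulr_natl mulfV // pnatr_eq0 -lt0n bin_gt0.
Qed.

Lemma Pr_total (R : realType) (n p k : nat) (Q : design R n p)
    (D : decoder R n p) : (k <= p)%N -> Pr k Q D (fun _ _ => true) = 1.
Proof.
move=> kp; rewrite -[RHS](defective_mass_sum1 R kp); apply: eq_bigr => S _.
rewrite -[RHS]mulr1 -(mass_sum1 Q) mulr_sumr; apply: eq_bigr => X _.
by rewrite -mulr_sumr mass_sum1 mulr1.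
Qed.

(* Main.v *)
(* Group the items into about c k blocks of m = 2^L items each, with m of order
   p / k, and spend L tests per block: the l-th one pools the items of the block
   whose offset has l-th binary digit 1. This takes about
   c k log2(p / k) tests, and an item that is the only defective of its block is
   read off exactly. Returning one item per block and padding to k items, it
   remains to see that a constant fraction of the blocks contain exactly one
   defective. Let Z be the number of these defectives. Each item of the blocks
   is counted with probability a, where m a >= 1/16, and two items of different
   blocks are both counted with probability b <= a^2 (1 + O(1/k)), since
   (x - m)(x + m) <= x^2 factor by factor in the binomials. So Chebyshev's
   inequality gives Z >= E[Z] / 2 with probability 1 - O(1/k). *)

Require Import Defs.
From mathcomp Require Import all_boot all_order all_algebra.
From mathcomp Require Import all_classical all_reals all_analysis.
From mathcomp Require Import zify ring lra.
Set Implicit Arguments.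
Unset Strict Implicit.
Unset Printing Implicit Defensive.
Import Order.TTheory GRing.Theory Num.Theory.
Import numFieldNormedType.Exports.
Local Open Scope ring_scope.

(** * Binomial estimates, counting by traces, Chebyshev and binary digits *)

Lemma ffact_mid_sqr (q m t : nat) :
  (q ^_ t * (q + m + m) ^_ t <= (q + m) ^_ t * (q + m) ^_ t)%N.
Proof.
elim: t => [|t IHt]; first by rewrite !ffactn0.
rewrite !ffactnSr mulnACA [leqRHS]mulnACA; apply: leq_mul IHt _; nia.
Qed.

(* With p = q + 2m and k = t + 2: decorrelation of two blocks, i.e.
   C(p-2m,k-2) C(p,k) / C(p-m,k-1)^2 <= ((p-t)/(p-m-t))^2. *)
Lemma bin_mid_sqr (q m t : nat) :
  ('C(q, t) * 'C(q + m + m, t.+2) * ((q + m - t) * (q + m - t))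
   <= 'C(q + m, t.+1) * 'C(q + m, t.+1) * ((q + m + m - t) * (q + m + m - t)))%N.
Proof.
(* Log-convexity of the factorial absorbs the mismatch between t, t + 2 and t + 1, t + 1 once the
   binomials become falling factorials. *)
have fact3 : (t.+1`! * t.+1`! <= t`! * t.+2`!)%N.
  rewrite !factS; have := fact_gt0 t; nia.
have h1 := bin_ffact q t; have h2 := bin_ffact (q + m + m) t.+2.
have h3 := bin_ffact (q + m) t.+1; have ffm := ffact_mid_sqr q m t.
rewrite -(leq_pmul2r (fact_gt0 t)) -(leq_pmul2r (fact_gt0 t.+2)).
set A := 'C(q, t) in h1 *; set B := 'C(_, t.+2) in h2 *; set C := 'C(_, _) in h3 *.
set u := (q + m - t)%N; set v := (q + m + m - t)%N.
have -> : (A * B * (u * u) * t`! * t.+2`! = (A * t`!) * (B * t.+2`!) * (u * u))%N by ring.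
rewrite h1 h2 !ffactnSr.
apply: (@leq_trans ((C * t.+1`!) * (C * t.+1`!) * (v * v))); last first.
  have -> : (C * t.+1`! * (C * t.+1`!) * (v * v) =
            C * C * (v * v) * (t.+1`! * t.+1`!))%N by ring.
  by rewrite -[leqRHS]mulnA leq_mul2l fact3 orbT.
rewrite h3 ffactnSr -/u -/v.
set f := (q ^_ t)%N in ffm *; set g := ((q + m + m) ^_ t)%N in ffm *.
set h := ((q + m) ^_ t)%N in ffm *.
have -> : (h * u * (h * u) * (v * v) = (h * h) * ((u * u) * (v * v)))%N by ring.
have -> : (f * (g * v * (q + m + m - t.+1)) * (u * u) =
  (f * g) * ((u * u) * (v * (q + m + m - t.+1))))%N by ring.
by apply: leq_mul => //; rewrite !leq_mul // /v leq_sub2l.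
Qed.

(** Pascal's rule is applied [m] times; each of the [m] terms it sheds is at most the largest
    one. *)
Lemma bin_addl_le (q m k : nat) :
  ('C(q + m, k.+1) <= 'C(q, k.+1) + m * 'C((q + m).-1, k))%N.
Proof.
elim: m => [|m IHm]; first by rewrite addn0 mul0n addn0.
rewrite addnS binS /= mulSn addnCA addnC leq_add2l.
apply: leq_trans IHm _; rewrite leq_add2l leq_mul2l.
by rewrite leq_bin2l ?leq_pred ?orbT.
Qed.

(** Such a set is [V] plus a free choice of the remaining elements outside [U]; the bijection sends
    [A] to [V :|: A]. *)
Lemma card_sets_setI (T : finType) (U V : {set T}) (k : nat) :
  V \subset U -> (#|V| <= k)%N ->
  #|[set S : {set T} | (#|S| == k) && (S :&: U == V)]|
    = 'C(#|T| - #|U|, k - #|V|).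
Proof.
move=> sVU leVk; have -> : (#|T| - #|U| = #|~: U|)%N by rewrite [RHS]cardsCs finset.setCK.
rewrite -cards_draws.
have disjVA (A : {set T}) : A \subset ~: U -> V :&: A = finset.set0.
  move=> sA; apply/eqP; rewrite finset.setI_eq0 finset.disjoints_subset.
  by apply: fintype.subset_trans sVU _; rewrite -finset.setCS finset.setCK.
rewrite -[RHS](card_in_imset (f := fun A => V :|: A)) => [|A B].
  apply: eq_card => S; rewrite finset.inE; apply/idP/imsetP => [/andP[/eqP Sk /eqP SU]|].
    exists (S :\: U); last by rewrite -SU finset.setID.
    by rewrite finset.inE finset.subsetDr cardsD SU Sk eqxx.
  move=> [A]; rewrite finset.inE => /andP[sA /eqP cA] ->.
  rewrite cardsU disjVA // cards0 subn0 cA subnKC // eqxx /= finset.setIUl.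
  rewrite (finset.setIidPl sVU) (_ : A :&: U = finset.set0) ?finset.setU0 //.
  by apply/eqP; rewrite finset.setI_eq0 finset.disjoints_subset.
rewrite !finset.inE => /andP[sA _] /andP[sB _] eqAB; apply/finset.setP => x.
have /finset.setP/(_ x) := eqAB; rewrite !finset.inE.
have /finset.setP/(_ x) := disjVA _ sA; have /finset.setP/(_ x) := disjVA _ sB.
rewrite !finset.inE.
by case: (x \in V); case: (x \in A); case: (x \in B).
Qed.

(** Chebyshev's inequality: [v] bounds the variance, and Z < mu / 2 forces (Z - mu)^2 >= (mu /
    2)^2. *)
Lemma chebyshev_half (R : realFieldType) (T : finType) (w Z : T -> R) (mu v : R) :
  (forall t, 0 <= w t) -> \sum_t w t = 1 -> 0 < mu ->
  \sum_t w t * Z t = mu -> \sum_t w t * Z t ^+ 2 <= mu ^+ 2 + v ->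
  1 - 4 * v / mu ^+ 2 <= \sum_(t | mu / 2 <= Z t) w t.
Proof.
move=> w0 w1 mu0 EZ EZ2.
move: (w1); rewrite (bigID (fun t => mu / 2 <= Z t)) /= => split1.
suff : \sum_(t | ~~ (mu / 2 <= Z t)) w t <= 4 * v / mu ^+ 2 by lra.
rewrite ler_pdivlMr ?exprn_gt0 //.
have Ev : \sum_t w t * (Z t - mu) ^+ 2 <= v.
  have -> : \sum_t w t * (Z t - mu) ^+ 2
      = \sum_t w t * Z t ^+ 2 - 2 * mu * \sum_t w t * Z t + mu ^+ 2 * \sum_t w t.
    rewrite !mulr_sumr -sumrB -big_split; apply: eq_bigr => t _ /=; ring.
  rewrite EZ w1; nra.
have : \sum_(t | ~~ (mu / 2 <= Z t)) w t * (mu / 2) ^+ 2 <= v.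
  apply: le_trans Ev.
  rewrite [leRHS](bigID (fun t => mu / 2 <= Z t)) /= -[leLHS]add0r lerD //.
    by apply: sumr_ge0 => t _; rewrite mulr_ge0 // sqr_ge0.
  apply: ler_sum => t; rewrite -ltNge => Zt; apply: ler_wpM2l => //.
  by nra.
rewrite -mulr_suml; lra.
Qed.

(** Digit 0 is the parity and the other digits are those of the half, so induction on [L]
    applies. *)
Lemma odd_digits_inj (L x y : nat) : (x < 2 ^ L)%N -> (y < 2 ^ L)%N ->
  (forall l, (l < L)%N -> odd (x %/ 2 ^ l) = odd (y %/ 2 ^ l)) -> x = y.
Proof.
elim: L x y => [|L IHL] x y; first by rewrite expn0; case: x; case: y.
rewrite expnS => xL yL xy; have := xy 0%N isT; rewrite expn0 !divn1 => oxy.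
suff hxy : x./2 = y./2 by rewrite -(odd_double_half x) -(odd_double_half y) oxy hxy.
apply: IHL => [||l lL]; [lia|lia|].
by rewrite -!divn2 -!divnMA -expnS; apply: xy.
Qed.

(** With k = t + 2, C(p, k) = (p / k) C(p - 1, k - 1) and p / k <= 8 m. Removing m - 1 more items
    loses at most the fraction (m - 1)(k - 1) / (p - 1) <= 1/2 of C(p - 1, k - 1), which costs the
    other factor 2 of 16. *)
Lemma bin_le_block (p m t : nat) : (0 < m)%N -> (4 * t.+2 * m <= p)%N ->
  (p <= 8 * t.+2 * m)%N -> ('C(p, t.+2) <= 16 * (m * 'C(p - m, t.+1)))%N.
Proof.
move=> m0 mp pm; have p2 : (1 < p)%N by nia.
have d1 := mul_bin_diag p t.+1; have d2 := mul_bin_diag p.-1 t.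
have h : ('C(p.-1, t.+1) <= 2 * 'C(p - m, t.+1))%N.
  have := bin_addl_le (p - m) m.-1 t; rewrite (_ : p - m + m.-1 = p.-1)%N; last by nia.
  have : (2 * (m.-1 * t.+1) <= p.-1)%N by nia.
  rewrite -(leq_pmul2l (_ : 0 < p.-1)%N); last by lia.
  move: d2; set x := 'C(p.-1, t.+1); set y := 'C(p - m, _); set z := 'C(_, t).
  by move=> d2 h1 h2; nia.
rewrite -(leq_pmul2l (isT : 0 < t.+2)%N) -d1; nia.
Qed.

Lemma defective_mass_ge0 (R : realType) (p k : nat) (S : {set 'I_p}) :
  0 <= defective_mass R k S.
Proof. by rewrite /defective_mass; case: ifP; rewrite ?invr_ge0. Qed.

(** * Second-moment bound for the number of isolated defectives *)

Section IsolatedItems.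
Variables (R : realType) (p : nat) (blk : 'I_p -> nat) (A : {set 'I_p}).
Variables (m N t : nat).
(** This form lets k - 1 and k - 2 occur as [t.+1] and [t], free of truncated subtraction. *)
Let k := t.+2.
Let B (j : 'I_p) := [set i | blk i == blk j].
Hypothesis m0 : (0 < m)%N.
Hypothesis cardB : forall j, j \in A -> #|B j| = m.
Hypothesis cardA : #|A| = (N * m)%N.
Hypothesis N0 : (0 < N)%N.
Hypothesis mp : (4 * k * m <= p)%N.
Hypothesis pm : (p <= 8 * k * m)%N.

Definition isolated_items (S : {set 'I_p}) : {set 'I_p} :=
  [set j in A | S :&: [set i | blk i == blk j] == [set j]].

Lemma sum_defective_mass (P : pred {set 'I_p}) :
  \sum_(S | P S) defective_mass R k S =
  #|[set S : {set 'I_p} | (#|S| == k) && P S]|%:R / 'C(p, k)%:R.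
Proof.
rewrite -big_mkcondr /= sumr_const mulr_natl; congr (_ *+ _).
by apply: eq_card => S; rewrite finset.inE andbC.
Qed.

Lemma prob_isolated1 j : j \in A ->
  \sum_(S | j \in isolated_items S) defective_mass R k S =
    'C(p - m, t.+1)%:R / 'C(p, k)%:R.
Proof.
move=> jA; rewrite sum_defective_mass -(cardB jA); congr (_%:R / _).
have sjB : [set j] \subset B j by rewrite finset.sub1set finset.inE.
have := card_sets_setI (k := k) sjB; rewrite finset.cards1 card_ord subn1 => <- //.
by apply: eq_card => S; rewrite !finset.inE jA.
Qed.

(** Two distinct items of one block are never both isolated. For different blocks, [S] must meet
    their union, of size 2 m, exactly in i and j. Allowing the second term for every pair makes the
    double sum collapse to M a + M^2 b. *)
Lemma prob_isolated2 i j : i \in A -> j \in A ->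
  \sum_(S | (i \in isolated_items S) && (j \in isolated_items S)) defective_mass R k S <=
  (if i == j then 'C(p - m, t.+1)%:R / 'C(p, k)%:R else 0)
   + 'C(p - m - m, t)%:R / 'C(p, k)%:R.
Proof.
move=> iA jA; have b0 : 0 <= 'C(p - m - m, t)%:R / 'C(p, k)%:R :> R by rewrite divr_ge0.
case: eqVneq => [<-|ij].
  by rewrite -(prob_isolated1 iA) ler_wpDr //; under eq_bigl do rewrite andbb.
rewrite add0r sum_defective_mass ler_wpM2r ?invr_ge0 // ler_nat.
have [bij|bij] := eqVneq (blk i) (blk j).
  rewrite (_ : [set S | _] = finset.set0) ?cards0 //; apply/finset.setP => S.
  rewrite !finset.inE iA jA bij /=; apply/negP => /and3P[_ /eqP-> /eqP/finset.set1_inj].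
  exact/eqP.
have dB : B i :&: B j = finset.set0.
  apply/finset.setP => x; rewrite !finset.inE.
  by case: eqVneq => //= ->; apply/negbTE.
have sVU : [set i; j] \subset B i :|: B j.
  by apply/fintype.subsetP => x; rewrite !finset.inE => /orP[]/eqP->; rewrite eqxx ?orbT.
have := card_sets_setI (k := k) sVU.
rewrite cards2 ij card_ord cardsU dB cards0 subn0 !cardB // subnDA subn2 => <- //.
apply/subset_leq_card/fintype.subsetP => S; rewrite !finset.inE iA jA /=.
by move=> /and3P[-> /eqP Si /eqP Sj]; rewrite finset.setIUr Si Sj eqxx.
Qed.

(** With M = N m items in [A], the mean is M a >= N / 16 and the second moment is at most (M a)^2 +
    M a + (2 / k) (M a)^2. Chebyshev loses 4 / (M a) + 8 / k <= 64 / N + 8 / k, and half the mean is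
    at least N / 32. *)
Lemma many_isolated_items :
  1 - (64 / N%:R + 8 / k%:R) <=
  \sum_(S : {set 'I_p} | N%:R / 32 <= #|isolated_items S|%:R :> R) defective_mass R k S.
Proof.
set a : R := 'C(p - m, t.+1)%:R / 'C(p, k)%:R.
set b : R := 'C(p - m - m, t)%:R / 'C(p, k)%:R.
have C0 : 0 < 'C(p, k)%:R :> R by rewrite ltr0n bin_gt0; nia.
have k0 : 0 < k%:R :> R by rewrite ltr0n.
have N0R : 0 < N%:R :> R by rewrite ltr0n.
have a_ge : 1 / 16 <= m%:R * a.
  rewrite mulrA ler_pdivlMr // -natrM; have := bin_le_block m0 mp pm.
  by rewrite -(ler_nat R) natrM -/k; lra.
have b_le : b <= a ^+ 2 * (1 + 2 / k%:R).
  have := bin_mid_sqr (p - m - m) m t.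
  rewrite (_ : p - m - m + m = p - m)%N; last by nia.
  rewrite (_ : p - m + m = p)%N; last by nia.
  set u := (p - m - t)%N; set v := (p - t)%N.
  have u0 : (0 < u)%N by nia.
  (* As v = u + m, this says 2 k m <= u, which follows from 4 k m <= p. *)
  have vu : (2 * k * v <= (2 * k + 1) * u)%N by rewrite /u /v /k; nia.
  rewrite -(ler_nat R) !natrM -/k => h.
  have {}h : b * u%:R ^+ 2 <= a ^+ 2 * v%:R ^+ 2.
    rewrite /a /b !expr_div_n -subr_ge0.
    rewrite (_ : _ - _ = ('C(p - m, t.+1)%:R ^+ 2 * v%:R ^+ 2
       - 'C(p - m - m, t)%:R * 'C(p, k)%:R * u%:R ^+ 2) / 'C(p, k)%:R ^+ 2); last first.
      by field; rewrite gt_eqF.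
    apply: divr_ge0; last by rewrite exprn_ge0.
    by rewrite subr_ge0 !expr2.
  have {}vu : v%:R <= (1 + 1 / (2 * k%:R)) * u%:R :> R.
    rewrite (_ : 1 + 1 / (2 * k%:R) = (2 * k%:R + 1) / (2 * k%:R)); last first.
      by field; rewrite gt_eqF.
    rewrite mulrAC ler_pdivlMr ?mulr_gt0 // mulrC.
    by move: vu; rewrite -(ler_nat R) !natrM natrD natrM.
  have u0R : 0 < u%:R :> R by rewrite ltr0n.
  rewrite -(ler_pM2r (exprn_gt0 2 u0R)); apply: le_trans h _.
  rewrite -[leRHS]mulrA ler_wpM2l ?sqr_ge0 //.
  apply: (@le_trans _ _ (((1 + 1 / (2 * k%:R)) * u%:R) ^+ 2)).
    by rewrite ler_sqr ?nnegrE // (le_trans _ vu).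
  rewrite exprMn ler_wpM2r ?sqr_ge0 //.
  (* With x = 1 / k, the goal is (1 + x / 2)^2 <= 1 + 2 x, true for 0 < x <= 1. *)
  have -> : 1 / (2 * k%:R) = k%:R^-1 / 2 :> R by field; rewrite gt_eqF.
  have : k%:R^-1 <= 1 :> R by rewrite invf_le1 // ler1n.
  have : 0 < k%:R^-1 :> R by rewrite invr_gt0.
  nra.
pose M := #|A|%:R : R.
have ME : M = N%:R * m%:R by rewrite /M cardA natrM.
have Ma_ge : N%:R / 16 <= M * a.
  rewrite ME -mulrA; have := ler_wpM2l (ltW N0R) a_ge; lra.
have Ma0 : 0 < M * a by apply: lt_le_trans Ma_ge; lra.
pose I (j : 'I_p) S : R := (j \in isolated_items S)%:R.
have ZE S : #|isolated_items S|%:R = \sum_(j in A) I j S.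
  rewrite -sum1_card natr_sum big_mkcond [RHS]big_mkcond /=; apply: eq_bigr => j _.
  by rewrite /I /isolated_items finset.inE; case: (j \in A) => //=; case: eqP.
have EI (P : pred {set 'I_p}) : \sum_S defective_mass R k S * (P S)%:R
    = \sum_(S | P S) defective_mass R k S :> R.
  rewrite [RHS]big_mkcond; apply: eq_bigr => S _.
  by case: (P S); rewrite ?mulr1 ?mulr0.
have kp : (k <= p)%N by nia.
apply: (@le_trans _ _ (1 - 4 * (M * a + 2 / k%:R * (M * a) ^+ 2) / (M * a) ^+ 2)).
  move: (M * a) Ma0 Ma_ge => y y0 y_ge.
  have -> : 4 * (y + 2 / k%:R * y ^+ 2) / y ^+ 2 = 4 / y + 8 / k%:R.
    by field; rewrite !gt_eqF.
  rewrite lerD2l lerN2 lerD2r ler_pdivrMr //.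
  have -> : 4 = 64 / N%:R * (N%:R / 16) :> R by field; rewrite gt_eqF.
  by rewrite ler_wpM2l // divr_ge0.
apply: (@le_trans _ _
    (\sum_(S : {set 'I_p} | M * a / 2 <= #|isolated_items S|%:R) defective_mass R k S)).
  apply: chebyshev_half => //.
  - exact: defective_mass_ge0.
  - exact: defective_mass_sum1.
  - under eq_bigr do rewrite ZE mulr_sumr; rewrite exchange_big /=.
    rewrite mulr_natl -sumr_const; apply: eq_bigr => j jA.
    by rewrite /a -(prob_isolated1 jA) -EI.
  - have -> : \sum_S defective_mass R k S * #|isolated_items S|%:R ^+ 2 =
       \sum_(i in A) \sum_(j in A)
         \sum_(S | (i \in isolated_items S) && (j \in isolated_items S))
           defective_mass R k S.
      under eq_bigr do rewrite ZE expr2 big_distrlr mulr_sumr.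
      rewrite exchange_big; apply: eq_bigr => i _.
      under eq_bigr do rewrite mulr_sumr.
      rewrite exchange_big; apply: eq_bigr => j _.
      by rewrite -EI; apply: eq_bigr => S _; rewrite /I /= -natrM mulnb.
    apply: (@le_trans _ _ (\sum_(i in A) \sum_(j in A) ((if i == j then a else 0) + b))).
      by apply: ler_sum => i iA; apply: ler_sum => j jA; apply: prob_isolated2.
    have -> : \sum_(i in A) \sum_(j in A) ((if i == j then a else 0) + b) =
        M * a + M ^+ 2 * b.
      under eq_bigr => i iA.
        rewrite big_split /= sumr_const -big_mkcondr (big_pred1 i); last first.
          move=> j; rewrite /= eq_sym; by case: eqVneq => [->|]; rewrite ?andbF ?andbT.
        over.
      by rewrite sumr_const -[LHS]mulr_natl -[b *+ _]mulr_natl -/M; ring.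
    have : M ^+ 2 * b <= M ^+ 2 * (a ^+ 2 * (1 + 2 / k%:R)).
      by rewrite ler_wpM2l ?sqr_ge0.
    by rewrite !exprMn; lra.
rewrite big_mkcond [leRHS]big_mkcond /=; apply: ler_sum => S _.
case: ifP => [h|_]; last by case: ifP => // _; apply: defective_mass_ge0.
by rewrite ifT //; move: h Ma_ge; lra.
Qed.

End IsolatedItems.

(** * Deterministic schemes as point masses *)

Lemma dirac_mass_sum1 (R : realType) (T : finType) (x : T) :
  \sum_t (t == x)%:R = 1 :> R.
Proof. by rewrite (bigD1 x) //= eqxx big1 ?addr0 // => t /negbTE->. Qed.

Definition fdirac (R : realType) (T : finType) (x : T) : fdist R T :=
  FDist (fun t => ler0n R (t == x)) (dirac_mass_sum1 R x).

Lemma Pr_deterministic (R : realType) (n p k : nat) (X : 'M[bool]_(n, p))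
    (f : {ffun 'I_n -> bool} -> {set 'I_p}) (E : {set 'I_p} -> {set 'I_p} -> bool) :
  Pr k (fdirac R X) (fun _ Y => fdirac R (f Y)) E =
  \sum_(S | E S (f (outcome X S))) defective_mass R k S.
Proof.
rewrite [RHS]big_mkcond; apply: eq_bigr => S _.
rewrite (bigD1 X) //= eqxx mulr1 [X in _ + X]big1 ?addr0 => [|X' /negbTE X'X]; last first.
  by apply: big1 => T _; rewrite X'X mulr0 mul0r.
case: ifP => ES.
  rewrite (bigD1 (f (outcome X S))) //= eqxx mulr1 big1 ?addr0 // => T /andP[_ /negbTE->].
  by rewrite mulr0.
apply: big1 => T ET; case: eqP => [TE|_]; last by rewrite mulr0.
by rewrite -TE ET in ES.
Qed.

Lemma Pr_le (R : realType) (n p k : nat) (Q : design R n p) (D : decoder R n p)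
    (E F : {set 'I_p} -> {set 'I_p} -> bool) :
  (forall S T, E S T -> F S T) -> Pr k Q D E <= Pr k Q D F.
Proof.
move=> EF; apply: ler_sum => S _; apply: ler_sum => X _.
rewrite big_mkcond [leRHS]big_mkcond /=; apply: ler_sum => T _.
case: ifP => [/EF->//|_]; case: ifP => // _.
by rewrite !mulr_ge0 ?defective_mass_ge0 ?mass_ge0.
Qed.

Lemma card_ord_interval (p a m : nat) : (a + m <= p)%N ->
  #|[set i : 'I_p | (a <= i < a + m)%N]| = m.
Proof.
move=> amp; have lt (r : 'I_m) : (a + r < p)%N.
  by apply: leq_trans amp; rewrite ltn_add2l.
rewrite -[RHS]card_ord -(card_imset _ (f := fun r => Ordinal (lt r))); last first.
  by move=> r s /(congr1 val) /= /addnI /val_inj.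
apply: eq_card => i; rewrite finset.inE; apply/idP/imsetP => [/andP[ai im]|[r _ ->]] /=.
  have rm : (i - a < m)%N by rewrite ltn_subLR.
  by exists (Ordinal rm) => //; apply: val_inj; rewrite /= subnKC.
by rewrite leq_addr ltn_add2l ltn_ord.
Qed.

(** * The binary-digit design and its decoder *)

Section Digits.
Variables (n p L N : nat).
Let m := (2 ^ L)%N.

(* The test number b * L + l, for b < N and l < L, pools the items j of block b
   (j %/ m = b) whose offset j %% m has l-th binary digit 1; tests beyond N * L
   are empty. *)
Definition digit_design : 'M[bool]_(n, p) :=
  \matrix_(i, j) [&& (i < N * L)%N, (j %/ m == i %/ L)%N & odd (j %% m %/ 2 ^ (i %% L))].

(** Each block is decoded as if it held exactly one defective; for any other block the item found
    may be wrong. *)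
Definition digit_match (Y : {ffun 'I_n -> bool}) : {set 'I_p} :=
  [set j : 'I_p | (j %/ m < N)%N &&
    [forall i : 'I_n, [&& (i < N * L)%N & (j %/ m == i %/ L)%N] ==>
       (Y i == odd (j %% m %/ 2 ^ (i %% L)))]].

Let m0 : (0 < m)%N. Proof. by rewrite expn_gt0. Qed.

(** Whatever [Y] is, it fixes all [L] digits of the offset of a match, so a block has at most one
    match. The bound N L <= n ensures that all these tests exist. *)
Lemma card_digit_match (Y : {ffun 'I_n -> bool}) :
  (N * L <= n)%N -> (#|digit_match Y| <= N)%N.
Proof.
move=> NLn; case: (posnP N) => [N0|].
  rewrite N0 leqn0 cards_eq0; apply/eqP/finset.setP => j.
  by rewrite !finset.inE N0.
(* [inord] needs an index type with a successor bound, hence the separate case N = 0. *)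
move=> N0; rewrite -[leqRHS](prednK N0) -[leqRHS]card_ord.
rewrite -(card_in_imset (f := fun j : 'I_p => inord (j %/ m) : 'I_N.-1.+1)) ?max_card //.
move=> i j; rewrite !finset.inE => /andP[iN /forallP iY] /andP[jN /forallP jY].
move=> /(congr1 val); rewrite /= !inordK ?prednK // => ij.
apply: val_inj => /=; rewrite (divn_eq i m) (divn_eq j m) ij; congr (_ + _)%N.
apply: (@odd_digits_inj L); rewrite ?ltn_pmod // => l lL.
have hN : (j %/ m * L + l < N * L)%N.
  apply: (@leq_trans ((j %/ m).+1 * L)); last by rewrite leq_mul2r jN orbT.
  by rewrite mulSn addnC ltn_add2r.
pose q := Ordinal (leq_trans hN NLn).
have L0 : (0 < L)%N by apply: leq_trans lL.
have := iY q; have := jY q; rewrite /= hN ij divnMDl // (divn_small lL) addn0 eqxx /=.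
by rewrite modnMDl (modn_small lL) => /eqP<- /eqP<-.
Qed.

(** When j is the only defective of its block, the disjunction in each test of the block reduces to
    the digit of j. *)
Lemma isolated_digit_match (S : {set 'I_p}) :
  isolated_items (fun j : 'I_p => j %/ m)%N [set j : 'I_p | (j %/ m < N)%N] S
    \subset digit_match (outcome digit_design S) :&: S.
Proof.
apply/fintype.subsetP => j; rewrite !finset.inE => /andP[-> /eqP Sj] /=.
have jS : j \in S by have := finset.set11 j; rewrite -Sj finset.inE => /andP[].
rewrite jS andbT; apply/forallP => i; apply/implyP => /andP[iNL ij].
rewrite ffunE; apply/eqP; apply/existsP/idP => [[j' /andP[j'S]]|oj].
  rewrite mxE => /and3P[_ ij' oj']; suff <- : j' = j by [].
  by apply/finset.set1P; rewrite -Sj !finset.inE j'S /= (eqP ij') (eqP ij).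
by exists j; rewrite jS mxE iNL ij.
Qed.

End Digits.

(** The estimate is the set of matches, at most N <= k of them, padded to [k] items; it contains
    every isolated defective. *)
Lemma digit_scheme (R : realType) (n p k L N : nat) :
  (1 < k)%N -> (0 < N)%N -> (N <= k)%N -> (N * L <= n)%N ->
  (4 * k * 2 ^ L <= p)%N -> (p <= 8 * k * 2 ^ L)%N ->
  exists (Q : design R n p) (D : decoder R n p),
    1 - (64 / N%:R + 8 / k%:R) <=
    Pr k Q D (fun S T => (#|T| == k) && (N%:R / 32 <= #|T :&: S|%:R :> R)).
Proof.
case: k => [|[|t]] // _ N0 Nk NLn mp pm; set k := t.+2 in Nk mp pm *.
set m := (2 ^ L)%N in mp pm *; have m0 : (0 < m)%N by rewrite expn_gt0.
(* The [N] blocks fit into the range of items, so each has exactly [m] items. *)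
have Nmp : (N * m <= p)%N by nia.
have kp : (k <= p)%N by nia.
pose X := digit_design n p L N.
have ext (Y : {ffun 'I_n -> bool}) : exists T : {set 'I_p},
    (#|T| == k) && (digit_match p L N Y \subset T).
  have dk : (#|digit_match p L N Y| <= k)%N.
    apply: leq_trans Nk; exact: card_digit_match.
  (* Taking U = V counts the [k]-sets containing the matches; the count is a positive binomial. *)
  have := card_sets_setI (fintype.subxx (digit_match p L N Y)) dk.
  set d := digit_match p L N Y; rewrite card_ord => cE.
  have : (0 < 'C(p - #|d|, k - #|d|))%N.
    by rewrite bin_gt0 leq_sub2r.
  rewrite -cE => /card_gt0P[T].
  rewrite finset.inE => /andP[Tk /eqP dT]; exists T; rewrite Tk /=.
  by apply/finset.setIidPl; rewrite finset.setIC.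
pose f Y := xchoose (ext Y).
have fP Y : (#|f Y| == k) && (digit_match p L N Y \subset f Y).
  exact: (xchooseP (ext Y)).
exists (fdirac R X), (fun _ Y => fdirac R (f Y)); rewrite Pr_deterministic.
apply: le_trans (@many_isolated_items R p (fun j : 'I_p => j %/ m)%N
  [set j : 'I_p | (j %/ m < N)%N] m N t m0 _ _ N0 mp pm) _.
- move=> j; rewrite finset.inE => jN; rewrite -[RHS](@card_ord_interval p (j %/ m * m) m).
    apply: eq_card => i; rewrite !finset.inE addnC -mulSn.
    by rewrite -leq_divRL // -ltn_divLR // ltnS eqn_leq andbC.
  by rewrite addnC -mulSn; apply: leq_trans Nmp; rewrite leq_mul2r jN orbT.
- rewrite -[RHS](@card_ord_interval p 0 (N * m)) ?add0n //.
  by apply: eq_card => i; rewrite !finset.inE ltn_divLR.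
rewrite big_mkcond [leRHS]big_mkcond /=; apply: ler_sum => S _.
case: ifP => [h|_]; last by case: ifP => // _; apply: defective_mass_ge0.
have /andP[-> dT] := fP (outcome X S); rewrite ifT //=.
apply: le_trans h _; rewrite ler_nat; apply: subset_leq_card.
exact: fintype.subset_trans (isolated_digit_match _ _ _ _) (finset.setSI _ dT).
Qed.

(** * Choice of parameters and number of tests *)

Lemma ln2_ge_half (R : realType) : 1 / 2 <= ln 2 :> R.
Proof.
have : ln (1 + - (1 / 2)) <= - (1 / 2) :> R by apply: le_ln1Dx; lra.
rewrite (_ : 1 + - (1 / 2) = 2^-1 :> R); last by field.
by rewrite lnV ?posrE //; lra.
Qed.

Lemma digit_scheme_log_tests (R : realType) (n p k : nat) (c : R) :
  0 < c -> c <= 1 -> (1 < k)%N -> 2 / c <= k%:R -> (4 * k <= p)%N ->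
  2 * c * k%:R * ln (p%:R / k%:R) <= n%:R ->
  exists (Q : design R n p) (D : decoder R n p),
    1 - (128 / c + 8) / k%:R <=
    Pr k Q D (fun S T => (#|T| == k) && (c / 64 * k%:R <= #|T :&: S|%:R :> R)).
Proof.
move=> c0 c1 k1 kc kp ln_n.
have kN : (0 < 4 * k)%N by lia.
have k_gt0 : (0 < k)%N by lia.
have p0 : (0 < p)%N by lia.
have k0 : 0 < k%:R :> R by rewrite ltr0n ltnW.
(* 2^L is the largest power of two with 4 k 2^L <= p, so p < 8 k 2^L. Since c k >= 2, rounding down
   keeps N >= c k / 2, which turns 64 / N into 128 / (c k) and N / 32 into c k / 64. As ln 2 >= 1/2,
   N L <= c k log2(p / k) <= 2 c k ln(p / k). *)
pose L := trunc_log 2 (p %/ (4 * k)); pose N := Num.truncn (c * k%:R).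
have /andP[NL NU] : N%:R <= c * k%:R < N.+1%:R.
  by apply: truncn_itv; rewrite mulr_ge0 ?ltW.
have ck : 2 <= c * k%:R by rewrite mulrC -ler_pdivrMr.
have Nc : c * k%:R / 2 <= N%:R by move: NU; rewrite -natr1; lra.
have N0 : (0 < N)%N by rewrite -(ltr0n R); lra.
have Nk : (N <= k)%N by rewrite -(ler_nat R); apply: le_trans NL _; rewrite ger_pMl.
have /andP[mL mU] : (2 ^ L <= p %/ (4 * k) < 2 ^ L.+1)%N.
  by apply: trunc_log_bounds => //; rewrite divn_gt0.
have mp : (4 * k * 2 ^ L <= p)%N by rewrite mulnC -leq_divRL.
have pm : (p <= 8 * k * 2 ^ L)%N.
  by move: mU; rewrite ltn_divLR // expnS; lia.
have NLn : (N * L <= n)%N.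
  rewrite -(ler_nat R) natrM; apply: le_trans ln_n.
  have : L%:R * ln 2 <= ln (p%:R / k%:R) :> R.
    rewrite mulr_natl -lnXn // ler_ln ?posrE ?exprn_gt0 ?divr_gt0 ?ltr0n //.
    by rewrite ler_pdivlMr // -natrX -natrM ler_nat; nia.
  have := ln2_ge_half R; move: (ln 2) (ln (p%:R / k%:R)) => x y x1 h.
  have L0 : 0 <= L%:R :> R by [].
  have {}h : L%:R <= 2 * y.
    have : L%:R * (1 / 2) <= L%:R * x by rewrite ler_wpM2l.
    lra.
  have -> : 2 * c * k%:R * y = c * k%:R * (2 * y) by ring.
  by apply: ler_pM.
have [Q [D QD]] := digit_scheme R k1 N0 Nk NLn mp pm.
exists Q, D; apply: le_trans (le_trans _ QD) _.
  rewrite lerD2l lerN2 [leRHS]mulrDl lerD2r ler_pdivrMr ?ltr0n //.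
  have -> : 64 = 128 / c / k%:R * (c * k%:R / 2) by field; rewrite !gt_eqF.
  by apply: ler_wpM2l => //; rewrite !divr_ge0 ?ltW.
apply: Pr_le => S T /andP[-> h] /=; lra.
Qed.

(** * Passage to the limit *)

Local Open Scope classical_set_scope.

Theorem corollary1 (R : realType) (k : nat -> nat)
    (k_infty : k p @[p --> \oo] --> \oo)
    (k_little_o : (fun p : nat => (k p)%:R : R) =o_\oo (fun p : nat => p%:R : R))
    (c0 : R) (c0_gt0 : 0 < c0) :
  exists2 delta : R, 0 < delta &
  forall n : nat -> nat,
    (\forall p \near \oo,
       c0 * (k p)%:R * ln (p%:R / (k p)%:R) <= (n p)%:R :> R) ->
  exists (Q : forall p, design R (n p) p) (D : forall p, decoder R (n p) p),
    Pr (k p) (Q p) (D p)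
       (fun S T => (#|T| == k p) && (delta * (k p)%:R <= #|T :&: S|%:R))
      @[p --> \oo] --> (1 : R).
Proof.
(* c <= 1 keeps the number of blocks at most k, and 2 c <= c0 keeps the tests within budget. *)
pose c := Num.min 1 (c0 / 2).
have c_gt0 : 0 < c by rewrite lt_min ltr01 divr_gt0.
have c_le1 : c <= 1 by rewrite ge_min lexx.
have c_le : 2 * c <= c0.
  have : c <= c0 / 2 by rewrite ge_min lexx orbT.
  by lra.
exists (c / 64) => [|n n_ge]; first by rewrite divr_gt0.
pose good p (QD : design R (n p) p * decoder R (n p) p) :=
  1 - (128 / c + 8) / (k p)%:R <= Pr (k p) QD.1 QD.2
    (fun S T => (#|T| == k p) && (c / 64 * (k p)%:R <= #|T :&: S|%:R :> R)).
(* A good scheme is only available for large p, but one must be chosen for every p: an arbitrary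
   default serves where none exists. *)
have ex p : exists QD, (exists QD', good p QD') -> good p QD.
  have [[QD QDP]|no] := pselect (exists QD, good p QD); first by exists QD.
  exists (fdirac R (const_mx false), fun _ _ => fdirac R finset.set0).
  by move=> /no.
pose QD p := projT1 (cid (ex p)).
have QDP p : (exists QD', good p QD') -> good p (QD p) by apply: (projT2 (cid (ex p))).
exists (fun p => (QD p).1), (fun p => (QD p).2).
have k_ge (r : R) : \forall p \near \oo, r <= (k p)%:R.
  exact: (k_infty _ (nbhs_infty_ger r)).
apply/cvgrPdist_le => e e0; near=> p.
have kp : (4 * k p <= p)%N.
  suff : `|(k p)%:R : R| <= 1 / 4 * `|p%:R : R|.
    by rewrite !ger0_norm // -(ler_nat R) natrM; lra.
  by near: p; move/eqoP: k_little_o; apply; lra.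
have k2 : (1 < k p)%N.
  by rewrite -(ler_nat R); near: p; exact: k_ge.
have kc : 2 / c <= (k p)%:R by near: p; exact: k_ge.
have k0 : 0 < (k p)%:R :> R by rewrite ltr0n ltnW.
have np : 2 * c * (k p)%:R * ln (p%:R / (k p)%:R) <= (n p)%:R.
  apply: (@le_trans _ _ (c0 * (k p)%:R * ln (p%:R / (k p)%:R))); last by near: p.
  (* Replacing c0 by 2 c lowers the bound because the logarithm is nonnegative, as k <= p. *)
  rewrite ler_wpM2r ?ler_wpM2r // ln_ge0 // ler_pdivlMr // mul1r ler_nat; lia.
have low : good p (QD p).
  have [Q [D QDg]] := digit_scheme_log_tests c_gt0 c_le1 k2 kc kp np.
  by apply: QDP; exists (Q, D).
set P := Pr _ _ _ _.
have P1 : P <= 1.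
  rewrite -(@Pr_total R (n p) p (k p) (QD p).1 (QD p).2); last by lia.
  exact: Pr_le.
rewrite ger0_norm ?subr_ge0 //.
have : (128 / c + 8) / (k p)%:R <= e.
  by rewrite ler_pdivrMr // -ler_pdivrMl //; near: p; exact: k_ge.
by move: low; rewrite /good -/P; lra.
Unshelve. all: by end_near.
Qed.
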